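(* Fix $\lambda>0$ and assume $D(\lambda)>0$. Let $\xi^\star(\lambda)\in\arg\min_{\xi\in\mathbb R}R_{\mathrm{sd}}(\lambda,\xi)$ and $R^\star_{\mathrm{sd}}(\lambda):=R_{\mathrm{sd}}(\lambda,\xi^\star(\lambda))=\min_{\xi\in\mathbb R}R_{\mathrm{sd}}(\lambda,\xi)$. Then $$\xi^\star(\lambda)=\frac{R(\lambda)-C(\lambda)}{D(\lambda)},\qquad R^\star_{\mathrm{sd}}(\lambda)=R(\lambda)-\frac{(R(\lambda)-C(\lambda))^2}{D(\lambda)}.$$ In particular, $R^\star_{\mathrm{sd}}(\lambda)\le R(\lambda)$ for all $\lambda>0$, and $\xi^\star(\lambda)$ may be negative (it is not restricted in sign).
   Context: Let $\mathcal D=(X,y)$ be training data with $X\in\mathbb R^{n\times p}$ (rows $x_i^\top$) and $y\in\mathbb R^n$; no distributional assumption is made on $\mathcal D$, and all statements hold conditionally on $\mathcal D$ (with probability one). For $\lambda>0$ the teacher ridge predictor is $f_\lambda(x)=x^\top\arg\min_{\beta\in\mathbb R^p}\{\|y-X\beta\|_2^2/n+\lambda\|\beta\|_2^2\}$. Let $\hat y_\lambda=f_\lambda(X)=(f_\lambda(x_1),\dots,f_\lambda(x_n))^\top$. The pure-distilled predictor $f_{\mathrm{pd},\lambda}$ is the ridge predictor trained on $(X,\hat y_\lambda)$ with the same penalty $\lambda$, i.e. $f_{\mathrm{pd},\lambda}(x)=x^\top\arg\min_{\beta}\{\|\hat y_\lambda-X\beta\|_2^2/n+\lambda\|\beta\|_2^2\}$.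 For $\xi\in\mathbb R$ the self-distilled predictor is $$f_{\mathrm{sd},\lambda,\xi}(x)=x^\top\arg\min_{\beta\in\mathbb R^p}\{(1-\xi)\|y-X\beta\|_2^2/n+\xi\|\hat y_\lambda-X\beta\|_2^2/n+\lambda\|\beta\|_2^2\}.$$ Let $(x_0,y_0)\in\mathbb R^p\times\mathbb R$ be a test point (possibly out-of-distribution, not necessarily independent of $\mathcal D$) with $\mathbb E[y_0^2\mid\mathcal D]<\infty$ and $\mathbb E[\|x_0\|_2^2\mid\mathcal D]<\infty$. For a predictor $f$ set $R(f)=\mathbb E[(y_0-f(x_0))^2\mid\mathcal D]$, and write $R(\lambda)=R(f_\lambda)$, $R_{\mathrm{sd}}(\lambda,\xi)=R(f_{\mathrm{sd},\lambda,\xi})$, $$C(\lambda)=\mathbb E[(y_0-f_\lambda(x_0))(y_0-f_{\mathrm{pd},\lambda}(x_0))\mid\mathcal D],\qquad D(\lambda)=\mathbb E[(f_\lambda(x_0)-f_{\mathrm{pd},\lambda}(x_0))^2\mid\mathcal D].$$ *)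

(* Defs.v *)
From HB Require Import structures.
From mathcomp Require Import all_boot all_order all_algebra.
From mathcomp Require Import all_classical all_reals all_analysis.

Set Implicit Arguments.
Unset Strict Implicit.
Unset Printing Implicit Defensive.

Import Order.TTheory GRing.Theory Num.Theory.
Import numFieldNormedType.Exports.

Local Open Scope classical_set_scope.
Local Open Scope ring_scope.

Definition argmin (R : realType) (T : Type) (J : T -> R) : set T :=
  [set a | forall b, J a <= J b].

(* Squared Euclidean norm; the library norm on matrices is the sup norm. *)
Definition sqnorm2 (R : realType) (m : nat) (v : 'cV[R]_m) : R :=
  \sum_(i < m) v i 0 ^+ 2.

Definition linear_predictor (R : realType) (p : nat) (b : 'cV[R]_p) :
  'cV[R]_p -> R := fun x => (x^T *m b) 0 0.

(* [xget 0 S] is some element of S if there is one; all the argmin sets in beta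
   below are singletons as soon as 0 < lambda. *)
Definition ridge (R : realType) (n p : nat) (X : 'M[R]_(n, p)) (y : 'cV[R]_n)
    (lambda : R) : 'cV[R]_p -> R :=
  linear_predictor (xget 0 (argmin (fun b : 'cV[R]_p =>
    sqnorm2 (y - X *m b) / n%:R + lambda * sqnorm2 b))).

(* f(X) = (f(x_1), ..., f(x_n)), where x_i^T is the i-th row of X. *)
Definition fitted (R : realType) (n p : nat) (f : 'cV[R]_p -> R)
    (X : 'M[R]_(n, p)) : 'cV[R]_n :=
  \col_(i < n) f (row i X)^T.

Definition pure_distilled (R : realType) (n p : nat) (X : 'M[R]_(n, p))
    (y : 'cV[R]_n) (lambda : R) : 'cV[R]_p -> R :=
  ridge X (fitted (ridge X y lambda) X) lambda.

Definition self_distilled (R : realType) (n p : nat) (X : 'M[R]_(n, p))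
    (y : 'cV[R]_n) (lambda xi : R) : 'cV[R]_p -> R :=
  linear_predictor (xget 0 (argmin (fun b : 'cV[R]_p =>
    (1 - xi) * sqnorm2 (y - X *m b) / n%:R
    + xi * sqnorm2 (fitted (ridge X y lambda) X - X *m b) / n%:R
    + lambda * sqnorm2 b))).

(* Random vectors and matrices take values in tuple types, which carry the
   product (= Borel) sigma-algebra; matrices have no measurable structure. *)
Notation data_space R n p := (n.-tuple (p.-tuple R) * n.-tuple R)%type.
Notation test_space R p := (p.-tuple R * R)%type.

Definition vec_of (R : realType) (m : nat) (t : m.-tuple R) : 'cV[R]_m :=
  \col_(i < m) tnth t i.

Definition design_of (R : realType) (n p : nat) (D : data_space R n p) :
  'M[R]_(n, p) := \matrix_(i < n, j < p) tnth (tnth D.1 i) j.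

Definition response_of (R : realType) (n p : nat) (D : data_space R n p) :
  'cV[R]_n := vec_of D.2.

(* kappa is a regular conditional distribution of Z given D.  Such a kernel
   always exists when Z takes values in test_space R p, and
   E[g(D, Z) | D] is then, almost surely, the integral of g(D, .) against
   kappa D. *)
Definition regular_conditional_distribution (R : realType)
    (d d1 d2 : measure_display) (Omega : measurableType d)
    (T1 : measurableType d1) (T2 : measurableType d2)
    (P : probability Omega R) (D : Omega -> T1) (Z : Omega -> T2)
    (kappa : R.-pker T1 ~> T2) : Prop :=
  forall (A : set T1) (B : set T2), measurable A -> measurable B ->
    P (D @^-1` A `&` Z @^-1` B) = (\int[P]_(w in D @^-1` A) kappa (D w) B)%E.

Definition distillation_setup (R : realType) (d : measure_display)
    (Omega : measurableType d) (P : probability Omega R) (n p : nat)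
    (D : {RV P >-> data_space R n p}) (x0 : {RV P >-> p.-tuple R})
    (y0 : {RV P >-> R})
    (kappa : R.-pker (data_space R n p) ~> (test_space R p)) : Prop :=
  [/\ regular_conditional_distribution P D (fun w => (x0 w, y0 w)) kappa,
      {ae P, forall w,
        (\int[kappa (D w)]_z ((z.2 ^+ 2)%:E) < +oo)%E} &
      {ae P, forall w,
        (\int[kappa (D w)]_z ((sqnorm2 (vec_of z.1))%:E) < +oo)%E}].

(* Below mu is a law of (x0, y0); it is instantiated with the conditional law
   given the data. *)
Definition pred_risk (R : realType) (p : nat)
    (mu : {measure set (test_space R p) -> \bar R}) (f : 'cV[R]_p -> R) : R :=
  \int[mu]_z ((z.2 - f (vec_of z.1)) ^+ 2).

Section conditional_quantities.
Context (R : realType) (n p : nat).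
Variables (kappa : R.-pker (data_space R n p) ~> (test_space R p)).
Variables (D : data_space R n p).

Let X := design_of D.
Let y := response_of D.

Definition teacher_risk (lambda : R) : R :=
  pred_risk (kappa D) (ridge X y lambda).

Definition sd_risk (lambda xi : R) : R :=
  pred_risk (kappa D) (self_distilled X y lambda xi).

Definition cross_risk (lambda : R) : R :=
  \int[kappa D]_z
    ((z.2 - ridge X y lambda (vec_of z.1))
     * (z.2 - pure_distilled X y lambda (vec_of z.1))).

Definition discrepancy (lambda : R) : R :=
  \int[kappa D]_z
    ((ridge X y lambda (vec_of z.1)
      - pure_distilled X y lambda (vec_of z.1)) ^+ 2).

End conditional_quantities.

(* Main.v *)
Require Import Defs.
From HB Require Import structures.
From mathcomp Require Import all_boot all_order all_algebra.
From mathcomp Require Import all_classical all_reals all_analysis.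
From mathcomp Require Import measurable_realfun ring lra.

Import Order.TTheory GRing.Theory Num.Theory.
Import numFieldNormedType.Exports.

Local Open Scope classical_set_scope.
Local Open Scope ring_scope.

(** Fix the data and [lambda > 0].  For a nonnegative weight [c], the ridge
    objective [c |u - X b|^2 + lambda |b|^2] has exactly one minimiser, given by
    the normal equation ([argmin_ridge_obj]), and this minimiser is linear in
    the labels [u].  The self-distillation objective is, up to a constant, the
    ridge objective for the mixed labels [(1 - xi) y + xi h], with [h] the fitted
    values of the teacher.  Hence ([self_distilledE]) the self-distilled
    predictor is the affine combination of the teacher [f] and of the
    pure-distilled predictor [g] with weights [1 - xi] and [xi].

    Let [u] and [v] be the residuals of [f] and [g] at the test point, which are
    square-integrable because the response and the features are.
    Expanding the mean square of [(1 - xi) u + xi v] gives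
    ([sd_risk_quadratic]) the risk [R - 2 xi (R - C) + xi^2 D].  If [D > 0],
    completing the square yields the unique minimiser [(R - C) / D] and the
    minimal value.  If [D = 0], this nonnegative function of [xi] is affine, hence
    constant, so a minimiser exists as well.  In both cases the value at
    [xi = 0] is the teacher risk, which bounds the minimum from above.  The two moment
    conditions hold for almost every realisation of the data, and the argument
    then works for all [lambda] at once ([distillation_optimum]).

    For the sign of the optimal weight, one deterministic training pair (1, 1)
    and a deterministic test point (1, t) give the optimal weight [2 - 4 t] for
    [lambda = 1] ([unit_sd_argmin]), which is negative for [t = 1] and positive
    for [t = 0]. *)

(** * Sets of minimisers *)

Lemma argmin_shift {R : realType} {T : Type} {J J' : T -> R} (k : R) :
  (forall a, J a = J' a + k) -> argmin J = argmin J'.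
Proof.
move=> JJ'; apply/seteqP; split=> a Ja b; move: (Ja b); rewrite !JJ' ?lerD2r//.
Qed.

Lemma xget_set1 {T : choiceType} (x0 : T) (S : set T) (x : T) :
  S = [set x] -> xget x0 S = x.
Proof. by move=> ->; apply: xget_unique. Qed.

(** * The ridge estimator *)

Section Ridge.
Context {R : realType}.

Lemma sqnorm2E {m : nat} (v : 'cV[R]_m) : sqnorm2 v = (v^T *m v) 0 0.
Proof. by rewrite mxE; apply: eq_bigr => i _; rewrite mxE expr2. Qed.

Lemma sqnorm2_ge0 {m : nat} (v : 'cV[R]_m) : 0 <= sqnorm2 v.
Proof. by apply: sumr_ge0 => i _; rewrite sqr_ge0. Qed.

Lemma sqnorm2_eq0 {m : nat} (v : 'cV[R]_m) : sqnorm2 v = 0 -> v = 0.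
Proof.
move/eqP; rewrite psumr_eq0 => [/allP v0|i _]; last by rewrite sqr_ge0.
apply/matrixP => i j; rewrite ord1 mxE; apply/eqP.
by have := v0 i (mem_index_enum i); rewrite /= sqrf_eq0.
Qed.

Lemma sqnorm2D {m : nat} (v w : 'cV[R]_m) :
  sqnorm2 (v + w) = sqnorm2 v + 2 * (v^T *m w) 0 0 + sqnorm2 w.
Proof.
rewrite mxE mulr_sumr -!big_split/=; apply: eq_bigr => i _.
by rewrite !mxE; ring.
Qed.

(** Mixing the two losses amounts to a single least-squares loss against the
    mixed labels: the extra term is free of [r], hence of the coefficients. *)
Lemma sqnorm2_affine {m : nat} (u v r : 'cV[R]_m) (xi : R) :
  (1 - xi) * sqnorm2 (u - r) + xi * sqnorm2 (v - r) =
  sqnorm2 (((1 - xi) *: u + xi *: v) - r) + xi * (1 - xi) * sqnorm2 (u - v).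
Proof.
rewrite !mulr_sumr -!big_split/=; apply: eq_bigr => i _.
by rewrite !mxE; ring.
Qed.

Context {n p : nat} (X : 'M[R]_(n, p)) (c lambda : R).
Hypotheses (c0 : 0 <= c) (lambda0 : 0 < lambda).

(** The weight [c] stands for [n%:R^-1]; only its nonnegativity matters, so
    that an empty sample, where [n%:R^-1] is [0], needs no separate case. *)
Definition ridge_obj (u : 'cV[R]_n) (b : 'cV[R]_p) : R :=
  c * sqnorm2 (u - X *m b) + lambda * sqnorm2 b.

Definition ridge_gram : 'M[R]_p := c *: (X^T *m X) + lambda%:M.

Definition ridge_coef (u : 'cV[R]_n) : 'cV[R]_p :=
  invmx ridge_gram *m (c *: (X^T *m u)).

(** The quadratic form of the Gram matrix at [v] is
    [c |X v|^2 + lambda |v|^2], so a vector of its kernel is null. *)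
Lemma ridge_gram_unit : ridge_gram \in unitmx.
Proof.
rewrite unitmxE unitfE; apply/negP => /det0P[v vn0 vG0].
have : c * sqnorm2 (X *m v^T) + lambda * sqnorm2 v^T = 0.
  transitivity ((v *m ridge_gram *m v^T) 0 0); last by rewrite vG0 mul0mx mxE.
  rewrite /ridge_gram !sqnorm2E trmx_mul !trmxK mulmxDr mulmxDl.
  by rewrite -scalemxAr -scalemxAl mul_mx_scalar -scalemxAl !mulmxA !mxE.
have := mulr_ge0 c0 (sqnorm2_ge0 (X *m v^T)).
have := sqnorm2_ge0 v^T => v0 cX0 E.
have /sqnorm2_eq0 vT0 : sqnorm2 v^T = 0.
  by apply/eqP; rewrite eq_le v0 andbT; rewrite -(pmulr_rle0 _ lambda0); lra.
by move: vn0; rewrite -[v]trmxK vT0 trmx0 eqxx.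
Qed.

Lemma ridge_normal_eq u :
  c *: (X^T *m (u - X *m ridge_coef u)) = lambda *: ridge_coef u.
Proof.
have : ridge_gram *m ridge_coef u = c *: (X^T *m u).
  by rewrite mulKVmx// ridge_gram_unit.
rewrite mulmxDl -scalemxAl mul_scalar_mx => E.
by rewrite mulmxBr scalerBr -E -(mulmxA X^T X) addrAC subrr add0r.
Qed.

(** Second-order expansion around the solution of the normal equation: that
    equation is what cancels the terms linear in [h]. *)
Lemma ridge_obj_shift u h :
  ridge_obj u (ridge_coef u + h) =
  ridge_obj u (ridge_coef u) + (c * sqnorm2 (X *m h) + lambda * sqnorm2 h).
Proof.
rewrite /ridge_obj mulmxDr opprD addrA.
have := congr1 (fun v : 'cV[R]_p => (v^T *m h) 0 0) (ridge_normal_eq u).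
have entryZ (a : R) (A : 'M[R]_1) : (a *: A) 0 0 = a * A 0 0 by rewrite mxE.
have entryN (A : 'M[R]_1) : (- A) 0 0 = - A 0 0 by rewrite mxE.
set b := ridge_coef u; set e := u - X *m b.
rewrite !linearZ/= -!scalemxAl !entryZ trmx_mul trmxK -mulmxA.
rewrite (sqnorm2D e) (sqnorm2D b) mulmxN entryN.
have -> : sqnorm2 (- (X *m h)) = sqnorm2 (X *m h).
  by apply: eq_bigr => i _; rewrite mxE sqrrN.
move: (_ 0 0) (_ 0 0) => s t st; lra.
Qed.

Lemma argmin_ridge_obj u : argmin (ridge_obj u) = [set ridge_coef u].
Proof.
apply/seteqP; split=> [b bmin|_ -> b]; last first.
  rewrite -[b](subrKC (ridge_coef u)) ridge_obj_shift lerDl.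
  by rewrite addr_ge0// mulr_ge0 ?sqnorm2_ge0// ltW.
have := bmin (ridge_coef u).
rewrite -{1}[b](subrKC (ridge_coef u)) ridge_obj_shift gerDl.
set h := b - _ => hle0.
have h0 := sqnorm2_ge0 h.
have cX0 := mulr_ge0 c0 (sqnorm2_ge0 (X *m h)).
have /sqnorm2_eq0 /eqP : sqnorm2 h = 0.
  by apply/eqP; rewrite eq_le h0 andbT -(pmulr_rle0 _ lambda0); lra.
by rewrite subr_eq0 => /eqP.
Qed.

Lemma ridge_coef_affine u v xi :
  ridge_coef ((1 - xi) *: u + xi *: v) =
  (1 - xi) *: ridge_coef u + xi *: ridge_coef v.
Proof.
rewrite /ridge_coef mulmxDr scalerDr mulmxDr -!scalemxAr !scalerA.
by rewrite ![c * _]mulrC.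
Qed.

End Ridge.

(** * Self-distillation as an affine path of predictors *)

Section Predictors.
Context {R : realType} {n p : nat} (X : 'M[R]_(n, p)) (y : 'cV[R]_n).
Context (lambda : R).
Hypothesis lambda0 : 0 < lambda.

Let coef := ridge_coef X n%:R^-1 lambda.

Lemma ridgeE u : ridge X u lambda = linear_predictor (coef u).
Proof.
congr linear_predictor; apply: xget_set1.
rewrite -argmin_ridge_obj ?invr_ge0//; apply: (argmin_shift 0) => b.
by rewrite addr0 /ridge_obj mulrC.
Qed.

(** The mixed objective is, up to a constant, the ridge objective of the labels
    [(1 - xi) y + xi h], where [h] are the fitted values of the teacher, and
    the ridge coefficients are linear in the labels. *)
Lemma self_distilledE xi x :
  self_distilled X y lambda xi x =
  (1 - xi) * ridge X y lambda x + xi * pure_distilled X y lambda x.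
Proof.
rewrite /pure_distilled; set h := fitted _ _; rewrite !ridgeE.
rewrite /self_distilled -/h.
rewrite (xget_set1 _ _ (coef ((1 - xi) *: y + xi *: h))).
  rewrite /coef ridge_coef_affine /linear_predictor.
  by rewrite mulmxDr -!scalemxAr !mxE.
rewrite -argmin_ridge_obj ?invr_ge0//.
apply: (argmin_shift (n%:R^-1 * (xi * (1 - xi) * sqnorm2 (y - h)))) => b.
by rewrite /ridge_obj -mulrDl sqnorm2_affine; ring.
Qed.

End Predictors.

(** * Quadratic functions of the mixing weight *)

Lemma argmin_quadratic {R : realType} (a b d : R) : 0 < d ->
  argmin (fun xi : R => a - 2 * xi * b + xi ^+ 2 * d) = [set b / d].
Proof.
move=> d0.
have E xi : a - 2 * xi * b + xi ^+ 2 * d =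
    d * (xi - b / d) ^+ 2 + (a - b ^+ 2 / d).
  by field; rewrite gt_eqF.
apply/seteqP; split => [xi ximin|_ -> xi] /=; last first.
  by rewrite !E lerD2r subrr expr0n/= mulr0 mulr_ge0 ?sqr_ge0// ltW.
have := ximin (b / d); rewrite !E lerD2r subrr expr0n/= mulr0 pmulr_rle0//.
by rewrite real_exprn_even_le0 ?num_real//= subr_eq0 => /eqP.
Qed.

(** A nonconstant affine function takes negative values on the line. *)
Lemma affine_ge0_slope0 {R : realFieldType} (a b : R) :
  (forall xi, 0 <= a - 2 * xi * b) -> b = 0.
Proof.
move=> H; apply/eqP/negPn/negP => b0.
(* At this weight the affine function equals -1. *)
have := H ((a + 1) / (2 * b)).
rewrite (_ : _ - _ = -1); last by field.
lra.
Qed.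

(** * Square-integrable residuals *)

Section SquareIntegrable.
Context {d} {T : measurableType d} {R : realType}.
Variable mu : {measure set T -> \bar R}.

Lemma Lfun2P (f : T -> R) : measurable_fun setT f ->
  (\int[mu]_z (f z ^+ 2)%:E < +oo)%E -> f \in Lfun mu 2%:E.
Proof.
move=> mf foo; rewrite inE; apply/andP; split; rewrite inE//=.
rewrite /finite_norm unlock poweR_lty//=.
rewrite (eq_integral (fun z => (f z ^+ 2)%:E))// => z _.
by rewrite /= powR_mulrn// real_normK ?num_real.
Qed.

(** Applied to the residuals [u] and [v] of the teacher and of the pure-distilled
    predictor, this is the quadratic expansion of the self-distilled risk. *)
Lemma Rintegral_affine_sqr (u v : T -> R) (xi : R) :
  u \in Lfun mu 2%:E -> v \in Lfun mu 2%:E ->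
  \int[mu]_z (((1 - xi) * u z + xi * v z) ^+ 2) =
  \int[mu]_z (u z ^+ 2)
  - 2 * xi * (\int[mu]_z (u z ^+ 2) - \int[mu]_z (u z * v z))
  + xi ^+ 2 * \int[mu]_z ((u z - v z) ^+ 2).
Proof.
move=> u2 v2.
have uu := Lfun2_integrable_sqr u2.
have vv := Lfun2_integrable_sqr v2.
have uv : mu.-integrable setT (EFin \o (fun z => u z * v z)).
  exact/Lfun1_integrable/Lfun2_mul_Lfun1.
have E a b c : \int[mu]_z (a * u z ^+ 2 + b * (u z * v z) + c * v z ^+ 2) =
  a * \int[mu]_z (u z ^+ 2) + b * \int[mu]_z (u z * v z)
  + c * \int[mu]_z (v z ^+ 2).
  have Z f k : mu.-integrable setT (EFin \o f) ->
      mu.-integrable setT (EFin \o (fun z => k * f z)).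
    move=> fi; rewrite (_ : _ \o _ = (fun z => k%:E * (EFin \o f) z)%E)//.
    exact: integrableZl.
  rewrite RintegralD//; [|exact: integrableD (Z _ _ _) (Z _ _ _)|exact: Z].
  by rewrite RintegralD ?RintegralZl//; exact: Z.
have -> : \int[mu]_z (((1 - xi) * u z + xi * v z) ^+ 2) =
  \int[mu]_z ((1 - xi) ^+ 2 * u z ^+ 2 + (2 * xi * (1 - xi)) * (u z * v z)
     + xi ^+ 2 * v z ^+ 2).
  by apply: eq_Rintegral => z _; ring.
have -> : \int[mu]_z ((u z - v z) ^+ 2) =
  \int[mu]_z (1 * u z ^+ 2 + (- 2) * (u z * v z) + 1 * v z ^+ 2).
  by apply: eq_Rintegral => z _; ring.
by rewrite !E; ring.
Qed.

End SquareIntegrable.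

Lemma measurable_coord {R : realType} {p : nat} (j : 'I_p) :
  measurable_fun setT (fun z : test_space R p => tnth z.1 j).
Proof.
apply: (@measurableT_comp _ _ _ _ _ _ (fun t : p.-tuple R => tnth t j)).
  exact: measurable_tnth.
exact: measurable_fst.
Qed.

Lemma measurable_sqnorm2_vec {R : realType} {p : nat} :
  measurable_fun setT (fun z : test_space R p => sqnorm2 (vec_of z.1)).
Proof.
rewrite /sqnorm2; apply: measurable_sum => j.
under eq_fun do rewrite mxE.
by apply: measurable_funX; exact: measurable_coord.
Qed.

Section Risk.
Context {R : realType} {p : nat}.
Variable mu : {measure set (test_space R p) -> \bar R}.
Hypothesis y2 : (\int[mu]_z ((z.2 ^+ 2)%:E) < +oo)%E.
Hypothesis x2 : (\int[mu]_z ((sqnorm2 (vec_of z.1))%:E) < +oo)%E.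

Lemma linear_predictorE (b : 'cV[R]_p) (t : p.-tuple R) :
  linear_predictor b (vec_of t) = \sum_(j < p) b j 0 * tnth t j.
Proof.
rewrite /linear_predictor mxE; apply: eq_bigr => j _.
by rewrite !mxE mulrC.
Qed.

(** Each squared coordinate of the features is dominated by their squared norm. *)
Lemma linear_predictor_Lfun2 (b : 'cV[R]_p) :
  (fun z : test_space R p => linear_predictor b (vec_of z.1)) \in Lfun mu 2%:E.
Proof.
have coordL2 (j : 'I_p) :
    (fun z : test_space R p => tnth z.1 j) \in Lfun mu 2%:E.
  apply: Lfun2P; first exact: measurable_coord.
  apply: le_lt_trans x2; apply: ge0_le_integral => //=.
  - by move=> z _; rewrite lee_fin sqr_ge0.
  - by apply/measurable_EFinP/measurable_funX; exact: measurable_coord.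
  - by apply/measurable_EFinP; exact: measurable_sqnorm2_vec.
  - move=> z _; rewrite lee_fin /sqnorm2 (bigD1 j)//= mxE lerDl.
    by apply: sumr_ge0 => i _; rewrite sqr_ge0.
rewrite (_ : (fun z => _) =
  \sum_(j < p) b j 0 *: (fun z : test_space R p => tnth z.1 j)); last first.
  by apply/funext => z; rewrite fct_sumE linear_predictorE.
have p1 : (1 <= 2%:E :> \bar R)%E by rewrite lee1n.
by apply: rpred_sum => j _; apply: rpredZ.
Qed.

Lemma residual_Lfun2 (b : 'cV[R]_p) :
  (fun z : test_space R p => z.2 - linear_predictor b (vec_of z.1))
    \in Lfun mu 2%:E.
Proof.
have p1 : (1 <= 2%:E :> \bar R)%E by rewrite lee1n.
apply: (@rpredB _ (Lfun mu 2%:E) snd); first exact: Lfun2P.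
exact: linear_predictor_Lfun2.
Qed.

End Risk.

(** * The optimal mixing weight *)

Section Distillation.
Context {R : realType} {n p : nat}.
Variables (kappa : R.-pker (data_space R n p) ~> (test_space R p)).
Variables (D : data_space R n p) (lambda : R).
Hypothesis lambda0 : 0 < lambda.
Hypothesis y2 : (\int[kappa D]_z ((z.2 ^+ 2)%:E) < +oo)%E.
Hypothesis x2 : (\int[kappa D]_z ((sqnorm2 (vec_of z.1))%:E) < +oo)%E.

Lemma sd_risk_quadratic xi :
  sd_risk kappa D lambda xi =
  teacher_risk kappa D lambda
  - 2 * xi * (teacher_risk kappa D lambda - cross_risk kappa D lambda)
  + xi ^+ 2 * discrepancy kappa D lambda.
Proof.
rewrite /teacher_risk /cross_risk /discrepancy /sd_risk /pred_risk.
set f := ridge _ _ _; set g := pure_distilled _ _ _.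
under [LHS]eq_Rintegral => z _ do rewrite self_distilledE//.
transitivity (\int[kappa D]_z (((1 - xi) * (z.2 - f (vec_of z.1))
  + xi * (z.2 - g (vec_of z.1))) ^+ 2)).
  by apply: eq_Rintegral => z _; rewrite -/f -/g; ring.
rewrite Rintegral_affine_sqr.
- congr (_ + _ * _); apply: eq_Rintegral => z _; ring.
- by rewrite /f ridgeE//; exact: residual_Lfun2.
- by rewrite /g /pure_distilled ridgeE//; exact: residual_Lfun2.
Qed.

Lemma discrepancy_ge0 : 0 <= discrepancy kappa D lambda.
Proof. by apply: Rintegral_ge0 => z _; rewrite sqr_ge0. Qed.

Lemma sd_risk_argmin : 0 < discrepancy kappa D lambda ->
  argmin (sd_risk kappa D lambda) =
  [set (teacher_risk kappa D lambda - cross_risk kappa D lambda)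
       / discrepancy kappa D lambda].
Proof.
move=> D0; rewrite -(argmin_quadratic (teacher_risk kappa D lambda))//.
by apply: (argmin_shift 0) => xi; rewrite sd_risk_quadratic addr0.
Qed.

(** With zero discrepancy the risk is affine in the mixing weight; being
    nonnegative on the whole line, it is constant. *)
Lemma sd_risk_cst xi : discrepancy kappa D lambda = 0 ->
  sd_risk kappa D lambda xi = teacher_risk kappa D lambda.
Proof.
move=> D0.
suff RC : teacher_risk kappa D lambda - cross_risk kappa D lambda = 0.
  by rewrite sd_risk_quadratic RC D0 !mulr0 subr0 addr0.
apply: affine_ge0_slope0 => t.
rewrite [leRHS](_ : _ = sd_risk kappa D lambda t); last first.
  by rewrite sd_risk_quadratic D0 mulr0 addr0.
by apply: Rintegral_ge0 => z _; rewrite sqr_ge0.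
Qed.

Lemma distillation_optimum :
  let Rl := teacher_risk kappa D lambda in
  let Rsd := sd_risk kappa D lambda in
  let Cl := cross_risk kappa D lambda in
  let Dl := discrepancy kappa D lambda in
  [/\ exists xistar : R, argmin Rsd xistar,
      0 < Dl -> forall xistar : R, argmin Rsd xistar ->
        xistar = (Rl - Cl) / Dl /\
        Rsd xistar = Rl - (Rl - Cl) ^+ 2 / Dl &
      forall xistar : R, argmin Rsd xistar -> Rsd xistar <= Rl].
Proof.
move=> Rl Rsd Cl Dl; split.
- have [D0|D0] := eqVneq Dl 0.
    by exists 0 => xi; rewrite /Rsd !sd_risk_cst.
  exists ((Rl - Cl) / Dl).
  by rewrite /Rsd sd_risk_argmin// lt0r D0 discrepancy_ge0.
- move=> D0 xi; rewrite /Rsd sd_risk_argmin// => ->; split=> //.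
  rewrite sd_risk_quadratic -/Rl -/Cl -/Dl.
  by field; rewrite gt_eqF.
(* The weight 0 gives back the teacher. *)
- move=> xi /(_ 0); rewrite {2}/Rsd sd_risk_quadratic -/Rl.
  by rewrite mulr0 mul0r subr0 expr0n mul0r addr0.
Qed.

End Distillation.

(** * Both signs of the optimal weight occur *)

Lemma Rintegral_dirac {d} {T : measurableType d} {R : realType} (a : T)
    (f : T -> R) : measurable_fun setT f -> \int[\d_a]_z f z = f a.
Proof.
move=> mf; rewrite /Rintegral integral_dirac//; last exact/measurable_EFinP.
by rewrite diracT mul1e.
Qed.

(** On one sample with feature 1 and [lambda = 1], the normal equation reads
    [u - b = b]: every ridge fit halves its label. *)
Lemma ridge_unit_design {R : realType} (u : 'cV[R]_1) (x : 'cV[R]_1) :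
  ridge (1%:M : 'M[R]_1) u 1 x = u 0 0 / 2 * x 0 0.
Proof.
rewrite ridgeE//.
have : 1%:R^-1 *: ((1%:M : 'M[R]_1)^T *m
    (u - 1%:M *m ridge_coef 1%:M 1%:R^-1 1 u))
    = 1 *: ridge_coef 1%:M 1%:R^-1 1 u.
  by apply: ridge_normal_eq => //; rewrite invr_ge0.
move: (ridge_coef _ _ _ _) => b.
rewrite trmx1 !mul1mx invr1 !scale1r => /matrixP/(_ 0 0); rewrite !mxE => ub.
rewrite /linear_predictor mxE big_ord1 mxE mulrC; congr (_ * _).
by lra.
Qed.

Lemma pure_distilled_unit_design {R : realType} (u : 'cV[R]_1) (x : 'cV[R]_1) :
  pure_distilled (1%:M : 'M[R]_1) u 1 x = u 0 0 / 4 * x 0 0.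
Proof.
rewrite /pure_distilled ridge_unit_design mxE ridge_unit_design !mxE eqxx mulr1.
by field.
Qed.

Section PointMassTest.
Context {R : realType} {p : nat} (z : test_space R p).

Lemma dirac_response_moment : (\int[\d_z]_z' ((z'.2 ^+ 2)%:E) < +oo)%E.
Proof.
rewrite integral_dirac//; first by rewrite diracT mul1e ltry.
by apply/measurable_EFinP; exact: measurable_funX.
Qed.

Lemma dirac_feature_moment :
  (\int[\d_z]_z' ((sqnorm2 (vec_of z'.1))%:E) < +oo)%E.
Proof.
rewrite integral_dirac//; first by rewrite diracT mul1e ltry.
by apply/measurable_EFinP; exact: measurable_sqnorm2_vec.
Qed.

Context {d : measure_display} {Omega : measurableType d}.
Context (P : probability Omega R) (n : nat) (D : data_space R n p).

Definition point_kernel : R.-pker (data_space R n p) ~> (test_space R p) :=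
  kdirac (@measurable_cst _ _ (data_space R n p) (test_space R p) setT z).

Lemma point_kernel_setup :
  distillation_setup (P := P) (cst D) (cst z.1) (cst z.2) point_kernel.
Proof.
split; [|apply: aeW => w; exact: dirac_response_moment
        |apply: aeW => w; exact: dirac_feature_moment].
move=> A B mA mB.
have mD : measurable (cst D @^-1` A : set Omega).
  by rewrite preimage_cst; case: ifP.
transitivity (\int[P]_(w in cst D @^-1` A) cst (\d_z B) w)%E => //.
rewrite integral_cst// diracE.
rewrite (_ : (fun w => _) = cst z); last by apply/funext => w; case: (z).
rewrite (preimage_cst z); case: ifP => _.
  by rewrite setIT mul1e.
by rewrite setI0 measure0 mul0e.
Qed.

End PointMassTest.

(** One training pair (1, 1), [lambda = 1], and a test point concentrated at
    (1, t): the teacher predicts 1/2 and the pure-distilled predictor 1/4, so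
    the optimal weight is the [xi] with [1/2 - xi / 4 = t]. It is
    negative when [t] lies above the teacher's prediction and positive when [t]
    lies below, since distilling once more shrinks the prediction. *)
Section UnitExample.
Context {R : realType} (t : R).

Definition unit_data : data_space R 1 1 := ([tuple [tuple 1]], [tuple 1]).
Definition unit_kernel : R.-pker (data_space R 1 1) ~> (test_space R 1) :=
  point_kernel ([tuple 1], t) 1.

Lemma design_of_unit_data : design_of unit_data = 1%:M.
Proof. by apply/matrixP => i j; rewrite !ord1 !mxE. Qed.

Lemma unit_ridgeE (z : test_space R 1) :
  ridge (design_of unit_data) (response_of unit_data) 1 (vec_of z.1)
  = 1 / 2 * tnth z.1 0.
Proof. by rewrite design_of_unit_data ridge_unit_design !mxE. Qed.

Lemma unit_pure_distilledE (z : test_space R 1) :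
  pure_distilled (design_of unit_data) (response_of unit_data) 1 (vec_of z.1)
  = 1 / 4 * tnth z.1 0.
Proof. by rewrite design_of_unit_data pure_distilled_unit_design !mxE. Qed.

Let mcoord (a : R) :
  measurable_fun setT (fun z : test_space R 1 => a * tnth z.1 0).
Proof. by apply: measurable_funM => //; exact: measurable_coord. Qed.

Let mresidual (a : R) :
  measurable_fun setT (fun z : test_space R 1 => z.2 - a * tnth z.1 0).
Proof. exact: measurable_funB. Qed.

Lemma unit_teacher_risk :
  teacher_risk unit_kernel unit_data 1 = (t - 1 / 2) ^+ 2.
Proof.
rewrite /teacher_risk /pred_risk.
under eq_Rintegral do rewrite unit_ridgeE.
rewrite Rintegral_dirac ?tnth0/= ?mulr1//.
exact: measurable_funX.
Qed.

Lemma unit_cross_risk :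
  cross_risk unit_kernel unit_data 1 = (t - 1 / 2) * (t - 1 / 4).
Proof.
rewrite /cross_risk.
under eq_Rintegral do rewrite unit_ridgeE unit_pure_distilledE.
rewrite Rintegral_dirac ?tnth0/= ?mulr1//.
exact: measurable_funM.
Qed.

Lemma unit_discrepancy : discrepancy unit_kernel unit_data 1 = 1 / 16.
Proof.
rewrite /discrepancy.
under eq_Rintegral do rewrite unit_ridgeE unit_pure_distilledE.
rewrite Rintegral_dirac; last by apply: measurable_funX; exact: measurable_funB.
by rewrite tnth0; field.
Qed.

Lemma unit_sd_argmin :
  argmin (sd_risk unit_kernel unit_data 1) = [set 2 - 4 * t].
Proof.
rewrite sd_risk_argmin// ?unit_discrepancy//.
- by rewrite unit_teacher_risk unit_cross_risk; congr [set _]; field.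
- exact: dirac_response_moment.
- exact: dirac_feature_moment.
Qed.

(** The predicate [Q] is instantiated with each of the two strict signs.  Data
    and test point being constant, any probability space carries them; a Dirac
    mass on the reals is one. *)
Lemma unit_example (Q : R -> Prop) : Q (2 - 4 * t) ->
  exists (d : measure_display) (Omega : measurableType d)
      (P : probability Omega R) (n p : nat)
      (D : {RV P >-> data_space R n p}) (x0 : {RV P >-> p.-tuple R})
      (y0 : {RV P >-> R})
      (kappa : R.-pker (data_space R n p) ~> (test_space R p)) (lambda : R),
    [/\ distillation_setup D x0 y0 kappa, 0 < lambda &
      {ae P, forall w, 0 < discrepancy kappa (D w) lambda /\
        exists2 xistar : R,
          argmin (sd_risk kappa (D w) lambda) xistar & Q xistar}].
Proof.
move=> Qt; exists _, R, \d_(0 : R), 1, 1.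
exists (cst unit_data), (cst [tuple 1]), (cst t), unit_kernel, 1; split=> //.
  exact: (point_kernel_setup ([tuple 1], t)).
apply: aeW => w; rewrite unit_discrepancy; split=> //.
by exists (2 - 4 * t); rewrite // unit_sd_argmin.
Qed.

End UnitExample.

Theorem proposition2p1 (R : realType) :
  (forall (d : measure_display) (Omega : measurableType d)
      (P : probability Omega R) (n p : nat)
      (D : {RV P >-> data_space R n p}) (x0 : {RV P >-> p.-tuple R})
      (y0 : {RV P >-> R})
      (kappa : R.-pker (data_space R n p) ~> (test_space R p)),
    distillation_setup D x0 y0 kappa ->
    {ae P, forall w, forall lambda : R, 0 < lambda ->
      let Rl := teacher_risk kappa (D w) lambda in
      let Rsd := sd_risk kappa (D w) lambda in
      let Cl := cross_risk kappa (D w) lambda in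
      let Dl := discrepancy kappa (D w) lambda in
      [/\ exists xistar : R, argmin Rsd xistar,
          0 < Dl -> forall xistar : R, argmin Rsd xistar ->
            xistar = (Rl - Cl) / Dl /\
            Rsd xistar = Rl - (Rl - Cl) ^+ 2 / Dl &
          forall xistar : R, argmin Rsd xistar -> Rsd xistar <= Rl]})
  /\
  (exists (d : measure_display) (Omega : measurableType d)
      (P : probability Omega R) (n p : nat)
      (D : {RV P >-> data_space R n p}) (x0 : {RV P >-> p.-tuple R})
      (y0 : {RV P >-> R})
      (kappa : R.-pker (data_space R n p) ~> (test_space R p)) (lambda : R),
    [/\ distillation_setup D x0 y0 kappa, 0 < lambda &
      {ae P, forall w, 0 < discrepancy kappa (D w) lambda /\
        exists2 xistar : R,
          argmin (sd_risk kappa (D w) lambda) xistar & xistar < 0}])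
  /\
  (exists (d : measure_display) (Omega : measurableType d)
      (P : probability Omega R) (n p : nat)
      (D : {RV P >-> data_space R n p}) (x0 : {RV P >-> p.-tuple R})
      (y0 : {RV P >-> R})
      (kappa : R.-pker (data_space R n p) ~> (test_space R p)) (lambda : R),
    [/\ distillation_setup D x0 y0 kappa, 0 < lambda &
      {ae P, forall w, 0 < discrepancy kappa (D w) lambda /\
        exists2 xistar : R,
          argmin (sd_risk kappa (D w) lambda) xistar & 0 < xistar}]).
Proof.
split; [|split].
- move=> d Omega P n p D x0 y0 kappa [_ y2 x2].
  apply: filterS2 y2 x2 => w y2 x2 lambda lambda0.
  exact: distillation_optimum.
- by apply: (unit_example 1 (fun xi => xi < 0)); lra.
- by apply: (unit_example 0 (fun xi => 0 < xi)); lra.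
Qed.
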